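(* Let $P\subseteq\mathbb{Z}^r$ be finite with $|P|\ge3$, and suppose that the affine dimension of $P$ is strictly less than $r$. Then there exists some $c=c_P>0$ such that $\mathsf{pdd}_P(\alpha)<\alpha^{c\log(1/\alpha)}$ for all $0<\alpha<1/2$.
   Context: The affine dimension of $P\subseteq\mathbb{Z}^r$ is the dimension of the smallest affine subspace of $\mathbb{R}^r$ containing $P$. Let $[N]=\{1,\dots,N\}$. For a finite $P\subseteq\mathbb{Z}^r$ and $0<\alpha<1$, the popular difference density $\mathsf{pdd}_P(\alpha)$ is the largest real number such that for every $\epsilon>0$ there exists $N_0=N_0(P,\epsilon)$ such that for every $N\ge N_0$ and every $A\subseteq[N]^r$ with $|A|\ge\alpha N^r$ there is some nonzero integer $d$ with $|\{x\in\mathbb{Z}^r : x+dy\in A \text{ for all } y\in P\}|\ge(\mathsf{pdd}_P(\alpha)-\epsilon)N^r$. *)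

(* Defs.v *)
From HB Require Import structures.
From mathcomp Require Import all_boot all_order all_algebra finmap.
From mathcomp Require Import all_classical all_reals all_analysis.

Set Implicit Arguments.
Unset Strict Implicit.
Unset Printing Implicit Defensive.

Import Order.TTheory GRing.Theory Num.Theory.

Local Open Scope fset_scope.
Local Open Scope classical_set_scope.
Local Open Scope ring_scope.

Definition affine_subspace (R : realType) (r : nat) (v : 'rV[R]_r)
    (U : {vspace 'rV[R]_r}) : set 'rV[R]_r :=
  [set v + u | u in [set` U]].

Definition real_points (R : realType) (r : nat) (P : {fset 'rV[int]_r}) :
    set 'rV[R]_r :=
  [set map_mx intr y | y in [set` P]].
Arguments real_points R {r} P _.

(* The dimension of an affine subspace [v + U] is that of its direction [U].  *)
Definition has_affine_dim (R : realType) (r : nat) (P : {fset 'rV[int]_r})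
    (k : nat) : Prop :=
  exists (v : 'rV[R]_r) (U : {vspace 'rV[R]_r}),
    [/\ real_points R P `<=` affine_subspace v U,
        forall v' U', real_points R P `<=` affine_subspace v' U' ->
          affine_subspace v U `<=` affine_subspace v' U'
      & \dim U = k].

Definition in_box (r N : nat) (x : 'rV[int]_r) : Prop :=
  forall i, 1 <= x ord0 i <= N%:Z.

Definition pattern_set (r : nat) (P A : {fset 'rV[int]_r}) (d : int) :
    set 'rV[int]_r :=
  [set x | forall y, y \in P -> x + d *: y \in A].

(* [fset_set] of an infinite set is empty; [pattern_set P A d] is finite as   *)
(* soon as [P] is nonempty, see [finite_pattern_set].                         *)
Definition pattern_count (r : nat) (P A : {fset 'rV[int]_r}) (d : int) : nat :=
  #|` fset_set (pattern_set P A d)|.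

Definition popular_densities (R : realType) (r : nat) (P : {fset 'rV[int]_r})
    (alpha : R) : set R :=
  [set p | forall eps : R, 0 < eps ->
    exists N0 : nat, forall N : nat, (N0 <= N)%N ->
    forall A : {fset 'rV[int]_r}, (forall x, x \in A -> in_box N x) ->
      alpha * N%:R ^+ r <= (#|` A|)%:R ->
      exists d : int, d != 0 /\
        (p - eps) * N%:R ^+ r <= (pattern_count P A d)%:R].

(* The supremum is a maximum, see [pdd_max].                                  *)
Definition pdd (R : realType) (r : nat) (P : {fset 'rV[int]_r}) (alpha : R) : R :=
  sup (popular_densities P alpha).

Lemma has_affine_dim_ex (R : realType) (r : nat) (P : {fset 'rV[int]_r}) :
  P != fset0 -> exists k, has_affine_dim R P k.
Proof.
case/fset0Pn => y0 y0P.
pose f (y : 'rV[int]_r) : 'rV[R]_r := map_mx intr y.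
pose U := <<[seq f y - f y0 | y <- enum_fset P]>>%VS.
exists (\dim U), (f y0), U; split => //.
  move=> _ [y yP <-]; exists (f y - f y0); last by rewrite addrC subrK.
  by apply/memv_span/map_f.
move=> v' U' sPU' _ [u /= uU <-].
have [u0 /= u0U' fy0] := sPU' (f y0) (ex_intro2 _ _ y0 y0P erefl).
exists (u0 + u); last by rewrite addrA fy0.
apply: memvD => //; suff /subvP : (U <= U')%VS by apply.
apply/span_subvP => _ /mapP[y yP ->].
have [w /= wU' <-] := sPU' (f y) (ex_intro2 _ _ y yP erefl).
by rewrite -fy0 opprD addrACA subrr add0r memvB.
Qed.

Lemma has_affine_dim_uniq (R : realType) (r : nat) (P : {fset 'rV[int]_r})
    (k k' : nat) :
  has_affine_dim R P k -> has_affine_dim R P k' -> k = k'.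
Proof.
have H (v v' : 'rV[R]_r) (U U' : {vspace 'rV[R]_r}) :
    affine_subspace v U `<=` affine_subspace v' U' -> (U <= U')%VS.
  move=> s; apply/subvP => u uU.
  have [w /= wU' e] := s (v + u) (ex_intro2 _ _ u uU erefl).
  have [w0 /= w0U' e0] := s (v + 0) (ex_intro2 _ _ 0 (mem0v U) erefl).
  have -> : u = w - w0.
    have := congr2 (fun a b => a - b) e e0.
    by rewrite addr0 [v + u]addrC addrK => <-; rewrite opprD addrACA subrr add0r.
  exact: memvB.
move=> [v [U [sP m <-]]] [v' [U' [sP' m' <-]]].
apply/eqP; rewrite eqn_leq; apply/andP; split; apply: dimvS.
  exact: H (m _ _ sP').
exact: H (m' _ _ sP).
Qed.

Lemma finite_pattern_set (r : nat) (P A : {fset 'rV[int]_r}) (d : int) :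
  P != fset0 -> finite_set (pattern_set P A d).
Proof.
case/fset0Pn => y yP; apply: (@sub_finite_set _ _ [set` [fset x - d *: y | x in A]]).
  move=> x /(_ y yP) xA /=; apply/imfsetP; exists (x + d *: y) => //.
  by rewrite addrK.
exact: finite_fset.
Qed.

Lemma pattern_count_le (r : nat) (P A : {fset 'rV[int]_r}) (d : int) :
  P != fset0 -> (pattern_count P A d <= #|` A|)%N.
Proof.
move=> P0; have fin := finite_pattern_set A d P0; case/fset0Pn: P0 => y yP.
have inj : injective (fun x : 'rV[int]_r => x + d *: y) by exact: addIr.
have <- : #|` [fset x + d *: y | x in fset_set (pattern_set P A d)]|
    = pattern_count P A d by rewrite card_imfset.
apply: fsubset_leq_card; apply/fsubsetP => _ /imfsetP[x /= xS ->].
by move: xS; rewrite in_fset_set // inE => /(_ y yP).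
Qed.

Lemma box_ex (r N : nat) : exists2 A : {fset 'rV[int]_r},
  forall x, x \in A <-> in_box N x & #|` A| = (N ^ r)%N.
Proof.
pose g (u : {ffun 'I_r -> 'I_N}) : 'rV[int]_r := \row_i (u i).+1%:Z.
have g_inj : injective g.
  move=> u v /rowP e; apply/ffunP => i; apply/val_inj.
  by have := e i; rewrite !mxE => -[].
exists [fset g u | u in {ffun 'I_r -> 'I_N}].
  move=> x; split.
    by case/imfsetP => u _ -> i; rewrite mxE !lez_nat ltn_ord.
  move=> bx.
  have h i : exists j : 'I_N, x ord0 i = j.+1%:Z.
    have /andP[] := bx i; case: (x ord0 i) => // -[//|n] _; rewrite lez_nat => nN.
    by exists (Ordinal nN).
  have [u ux] := choice h.
  apply/imfsetP; exists [ffun i => u i] => //.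
  by apply/rowP => i; rewrite mxE ffunE ux.
rewrite card_imfset //= -cardE.
by rewrite card_ffun !card_ord.
Qed.

Lemma pdd_max (R : realType) (r : nat) (P : {fset 'rV[int]_r}) (alpha : R) :
  P != fset0 -> 0 < alpha < 1 ->
  popular_densities P alpha (pdd P alpha) /\
  ubound (popular_densities P alpha) (pdd P alpha).
Proof.
move=> P0 /andP[_ alpha1].
have hs : has_sup (popular_densities P alpha).
  split.
    exists 0 => eps eps0; exists 0%N => N _ A _ _; exists 1; split => //.
    rewrite sub0r mulNr; apply: (@le_trans _ _ 0) => //.
    by rewrite oppr_le0 mulr_ge0 ?exprn_ge0 // ltW.
  exists 2 => p /(_ 1 ltr01)[N0 /(_ N0.+1 (leqnSn _))].
  have [A Abox cardA] := box_ex r N0.+1.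
  have Npos : 0 < N0.+1%:R ^+ r :> R by rewrite exprn_gt0.
  case/(_ A (fun x => (Abox x).1)) => [|d [_]].
    by rewrite cardA natrX ler_piMl ?ltW.
  have := pattern_count_le A d P0; rewrite cardA -(ler_nat R) natrX => le1 le2.
  have := le_trans le2 le1; rewrite -[leRHS]mul1r ler_pM2r //.
  by rewrite lerBlDr.
split; last by move=> p pP; apply: sup_upper_bound.
move=> eps eps0.
have e2 : 0 < eps / 2 by rewrite divr_gt0.
have [p pP plt] := sup_adherent e2 hs.
have [N0 H] := pP _ e2; exists N0 => N N0N A Abox cardA.
have [d [d0 le]] := H N N0N A Abox cardA; exists d; split => //.
apply: le_trans le; rewrite ler_wpM2r ?exprn_ge0 //.
rewrite lerBrDr {1}(splitr eps) opprD addrA subrK.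
exact: ltW.
Qed.

(* Main.v *)
Require Import Defs.
From HB Require Import structures.
From mathcomp Require Import all_boot all_order all_algebra finmap zify ring lra.
From mathcomp Require Import all_classical all_reals all_analysis.

(* Take N = p prime, pass to F_p^r, and keep three points y1, y2, y3 of P.
   As P is degenerate, some linear form w <> 0 is constant on them, while
   another form l takes increasing integer values with gaps mu and lam.
   On each hyperplane w = t choose theta_t, phi_t in F_p^n independently and
   uniformly, and let
     A = {x : l(x) theta_t + phi_t \in S for t = w(x)},
   where S is a thickened Behrend set: a union of boxes indexed by the integer
   points of a sphere, dense, but whose solutions of
   lam s1 + mu s3 = (lam + mu) s2 stay in a single box.  For every d <> 0 the
   pattern of x with difference d is then distributed like a random such
   solution, and the hyperplanes are independent, so a Chernoff bound handles
   all d <> 0 modulo p at once.  With 2^n points per side of the sphere's cube,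
   the density is 2^(-O(n)) whereas the pattern density is at most 4 * 2^(-n^2). *)

Set Implicit Arguments.
Unset Strict Implicit.
Unset Printing Implicit Defensive.

Import Order.TTheory GRing.Theory Num.Theory.

Local Open Scope fset_scope.
Local Open Scope ring_scope.

(** * Probabilistic selection by an exponential moment *)

(** Since [1 - x / 2 <= expR (- (x / 2))], it is enough that [(1 + x) * (1 - x / 2) >= 1] on
    [[0, 1]]. It turns a bound on a product of factors [1 + X_i] into one on [\sum_i X_i]. *)
Lemma expR_half_le1D (R : realType) (x : R) : 0 <= x <= 1 -> expR (x / 2) <= 1 + x.
Proof.
move=> /andP[x0 x1].
have h : 1 - x / 2 <= expR (- (x / 2)) by rewrite -[1 - _]/(1 + - _) expR_ge1Dx.
rewrite -[x / 2]opprK expRN -[leRHS]invrK lef_pV2 ?posrE ?expR_gt0 //; last first.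
  by rewrite invr_gt0; lra.
apply: le_trans h; rewrite -[(1 + x)^-1]mul1r ler_pdivrMr; nra.
Qed.

(* The exponential moment [E exp (sum X_i / 2)] is replaced by
   [E (prod (1 + X_i))], which factorizes over the independent coordinates. *)
Lemma random_choice (R : realType) (I Om E J : finType) (tau : E -> I)
    (G : E -> {set Om}) (H : J -> E -> {set Om}) (M : nat)
    (sg bt s al : R) :
  (0 < M)%N -> (0 < #|E|)%N -> (0 < #|Om|)%N -> 0 <= al -> 0 <= bt ->
  (forall i, (#|[set x | tau x == i]| <= M)%N) ->
  (forall x, sg * #|Om|%:R <= #|G x|%:R) ->
  (forall j x, #|H j x|%:R <= bt * #|Om|%:R) ->
  al + #|J|%:R * expR (- s) <= sg ->
  exists om : {ffun I -> Om},
    al * #|E|%:R <= #|[set x | om (tau x) \in G x]|%:R /\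
    forall j, #|[set x | om (tau x) \in H j x]|%:R <=
      2 * M%:R * (bt * #|I|%:R + s).
Proof.
move=> M0 E0 Om0 al0 bt0 fibM Gsg Hbt alJ.
have M0' : 0 < M%:R :> R by rewrite ltr0n.
have E0' : 0 < #|E|%:R :> R by rewrite ltr0n.
have O0' : 0 < #|Om|%:R :> R by rewrite ltr0n.
(* The contribution of the fibre over [i] to the [j]-th count, divided by [M] so as to lie in
   [[0, 1]]; its mean over [o] is at most [bt]. *)
pose X j i (o : Om) : R := #|[set x | (tau x == i) && (o \in H j x)]|%:R / M%:R.
have X01 j i o : 0 <= X j i o <= 1.
  rewrite divr_ge0 //= ler_pdivrMr // mul1r ler_nat.
  apply: leq_trans (fibM i); apply: subset_leq_card.
  by apply/fintype.subsetP => x; rewrite !inE => /andP[].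
have sumX j i : \sum_o X j i o <= bt * #|Om|%:R.
  rewrite -mulr_suml ler_pdivrMr //.
  have -> : \sum_o #|[set x | (tau x == i) && (o \in H j x)]|%:R
      = \sum_(x | tau x == i) #|H j x|%:R :> R.
    rewrite -!natr_sum; congr (_%:R).
    under eq_bigr do rewrite cardsE -sum1_card.
    under [RHS]eq_bigr do rewrite -sum1_card.
    rewrite (exchange_big_dep (fun x => tau x == i)) /=.
      by apply: eq_bigr => x xi; apply: eq_bigl => o; rewrite unfold_in /= xi.
    by move=> o x _; rewrite unfold_in /= => /andP[].
  apply: le_trans (_ : \sum_(x | tau x == i) bt * #|Om|%:R <= _).
    by apply: ler_sum.
  rewrite sumr_const -[leLHS]mulr_natr ler_wpM2l ?mulr_ge0 // ler_nat.
  by apply: leq_trans (fibM i); rewrite cardsE.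
pose W : R := #|Om|%:R ^+ #|I|.
have W0 : 0 < W by rewrite exprn_gt0.
have WE : W = \sum_(om : {ffun I -> Om}) 1.
  by rewrite sumr_const card_ffun natrX.
pose Q j (om : {ffun I -> Om}) : R := \prod_i (1 + X j i (om i)).
have sumQ j : \sum_om Q j om <= W * expR (bt * #|I|%:R).
  rewrite -(bigA_distr_bigA (fun i o => 1 + X j i o)) /= expRM_natr.
  rewrite /W -exprMn -[leRHS]prodr_const.
  apply: ler_prod => i _; apply/andP; split.
    by apply: sumr_ge0 => o _; case/andP: (X01 j i o) => *; lra.
  rewrite big_split /= sumr_const.
  apply: le_trans (_ : #|Om|%:R + bt * #|Om|%:R <= _).
    by rewrite lerD2l sumX.
  by rewrite -{1}[#|Om|%:R]mul1r -mulrDl mulrC ler_wpM2l // expR_ge1Dx.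
pose A (om : {ffun I -> Om}) := [set x | om (tau x) \in G x].
have marg i (B : {set Om}) : \sum_(om : {ffun I -> Om} | om i \in B) 1
    = W * (#|B|%:R / #|Om|%:R) :> R.
  (* The indicator of [om i \in B], written as a product over all coordinates so that the sum over
     [om] factorizes. *)
  pose g i' o : R := if i' == i then (o \in B)%:R else 1.
  have -> : \sum_(om : {ffun I -> Om} | om i \in B) 1 = \prod_i' \sum_o g i' o.
    rewrite bigA_distr_bigA big_mkcond /=; apply: eq_bigr => om _.
    rewrite (bigD1 i) //= big1 ?mulr1 /g ?eqxx; first by case: (_ \in _).
    by move=> i' /negPf ->.
  rewrite (bigD1 i) //= /g eqxx.
  have -> : \sum_o (o \in B)%:R = #|B|%:R :> R.
    rewrite -sum1_card natr_sum [RHS]big_mkcond.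
    by apply: eq_bigr => o _; case: (_ \in _).
  rewrite (eq_bigr (fun=> #|Om|%:R)); last first.
    by move=> i' /negPf ->; rewrite sumr_const.
  have I0 : (0 < #|I|)%N by apply/card_gt0P; exists i.
  rewrite prodr_const cardC1 /W -{2}(prednK I0) exprS.
  by field; rewrite gt_eqF.
have sumA : W * (sg * #|E|%:R) <= \sum_om #|A om|%:R.
  have -> : \sum_om #|A om|%:R = \sum_x W * (#|G x|%:R / #|Om|%:R) :> R.
    under eq_bigr do rewrite /A cardsE -sum1_card natr_sum big_mkcond /=.
    rewrite exchange_big /=; apply: eq_bigr => x _.
    by rewrite -(marg (tau x)) [RHS]big_mkcond.
  rewrite -mulr_sumr ler_pM2l // mulr_natr -sumr_const.
  by apply: ler_sum => x _; rewrite ler_pdivlMr.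
pose c := expR (- (bt * #|I|%:R + s)).
have c0 : 0 < c by exact: expR_gt0.
(* A single score: the density of [A om] minus a penalty for all [j] together. The weight [c] makes
   the mean penalty at most [#|J| * expR (- s)], so the mean score is at least [al], and one [om]
   reaching it serves both conclusions. *)
pose F om : R := #|A om|%:R / #|E|%:R - c * \sum_j Q j om.
have sumF : W * al <= \sum_om F om.
  rewrite big_split /= sumrN -mulr_suml -mulr_sumr exchange_big /=.
  have h1 : W * sg <= (\sum_om #|A om|%:R) / #|E|%:R.
    by rewrite ler_pdivlMr // -mulrA.
  have h2 : c * \sum_j \sum_om Q j om <= W * (#|J|%:R * expR (- s)).
    have -> : W * (#|J|%:R * expR (- s)) = c * \sum_(j : J) W * expR (bt * #|I|%:R).
      rewrite sumr_const -[(_ * _) *+ _]mulr_natr /c opprD expRD.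
      have : expR (- (bt * #|I|%:R)) * expR (bt * #|I|%:R) = 1.
        by rewrite -expRD addNr expR0.
      set u := expR (- (bt * _)); set v := expR (bt * _) => uv.
      by rewrite -[LHS]mulr1 -[X in _ * X = _]uv; ring.
    by rewrite ler_pM2l //; apply: ler_sum => j _; exact: sumQ.
  have := ler_wpM2l (ltW W0) alJ; rewrite mulrDr; lra.
have [om Fom] : exists om, al <= F om.
  apply/existsP; apply: contraTT sumF => /existsPn H'.
  rewrite -ltNge WE mulr_suml; under [ltRHS]eq_bigr do rewrite mul1r.
  apply: ltr_sum => [|om _]; last by rewrite ltNge H'.
  have /card_gt0P[om0 _] : (0 < #|{ffun I -> Om}|)%N.
    by rewrite card_ffun expn_gt0 Om0.
  by apply/hasP; exists om0; rewrite ?mem_index_enum.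
have Q0 j : 0 <= Q j om.
  by apply: prodr_ge0 => i _; case/andP: (X01 j i (om i)) => *; lra.
exists om; split.
  rewrite -ler_pdivlMr //; apply: le_trans Fom _.
  by rewrite /F lerBlDr lerDl mulr_ge0 ?(ltW c0) ?sumr_ge0.
move=> j.
have A1 : #|A om|%:R / #|E|%:R <= 1 :> R.
  by rewrite ler_pdivrMr // mul1r ler_nat max_card.
(* The score is nonnegative and the density at most 1, so the whole penalty is at most 1, and with
   it each of its nonnegative terms. *)
have Qle : Q j om <= expR (bt * #|I|%:R + s).
  have : c * \sum_j Q j om <= 1 by move: Fom A1; rewrite /F; lra.
  rewrite /c expRN ler_pdivrMl ?expR_gt0 // mulr1; apply: le_trans.
  by rewrite (bigD1 j) //= lerDl sumr_ge0.
have : expR ((\sum_i X j i (om i)) / 2) <= expR (bt * #|I|%:R + s).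
  apply: le_trans Qle; rewrite mulr_suml expR_sum.
  by apply: ler_prod => i _; rewrite expR_ge0 expR_half_le1D.
rewrite ler_expR ler_pdivrMr // => Xle.
have -> : #|[set x | om (tau x) \in H j x]|%:R = M%:R * \sum_i X j i (om i).
  rewrite -mulr_suml mulrC divfK ?gt_eqF // -natr_sum; congr (_%:R).
  rewrite -sum1_card (partition_big tau predT) //=; apply: eq_bigr => i _.
  rewrite -sum1_card; apply: eq_bigl => x; rewrite !inE andbC.
  by case: eqP => // ->.
by rewrite -mulrA mulrCA ler_pM2l // mulrC.
Qed.

(** * Behrend-type sets over a prime field *)

(** The squared norm takes fewer than [n * D ^ 2] distinct values on the [D ^ n] points of the cube,
    so some sphere is at least as rich as the average. *)
Lemma sphere_pigeonhole (n D : nat) : (0 < n)%N -> (0 < D)%N ->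
  exists r : nat, (D ^ n <= #|[set b : {ffun 'I_n -> 'I_D} |
    (\sum_j b j ^ 2)%N == r]| * (n * D ^ 2))%N.
Proof.
move=> n0 D0.
pose f (b : {ffun 'I_n -> 'I_D}) := (\sum_j b j ^ 2)%N.
have fb b : (f b < n * D ^ 2)%N.
  apply: (@leq_ltn_trans (\sum_(j < n) D.-1 ^ 2)).
    by apply: leq_sum => j _; rewrite leq_exp2r // -ltnS prednK.
  by rewrite sum_nat_const card_ord ltn_pmul2l // ltn_exp2r // prednK.
pose g b : 'I_(n * D ^ 2) := Ordinal (fb b).
have N0 : (0 < n * D ^ 2)%N by rewrite muln_gt0 n0 expn_gt0 D0.
pose F (i : 'I_(n * D ^ 2)) := #|[set b | f b == i]|.
have sumF : (\sum_i F i = D ^ n)%N.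
  have <- : (\sum_(b : {ffun 'I_n -> 'I_D}) 1 = D ^ n)%N.
    by rewrite sum1_card card_ffun !card_ord.
  rewrite (partition_big g predT) //=; apply: eq_bigr => i _.
  by rewrite /F -sum1_card; apply: eq_bigl => b; rewrite inE.
have N0' : (0 < #|'I_(n * D ^ 2)|)%N by rewrite card_ord.
have [i Fi] := bigop.eq_bigmax F N0'.
exists i; rewrite -[X in (_ <= X * _)%N]/(F i) -Fi -sumF.
apply: (@leq_trans (\sum_(j < n * D ^ 2) \max_i F i)).
  by apply: leq_sum => j _; exact: bigop.leq_bigmax.
by rewrite sum_nat_const card_ord mulnC.
Qed.

(** Strict convexity of the sphere: a weighted mean of two of its points lies on it only if the
    points coincide. *)
Lemma sphere_convex (n D lam mu r : nat) (b1 b2 b3 : {ffun 'I_n -> 'I_D}) :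
  (0 < lam)%N -> (0 < mu)%N ->
  (\sum_j b1 j ^ 2 = r)%N -> (\sum_j b2 j ^ 2 = r)%N -> (\sum_j b3 j ^ 2 = r)%N ->
  (forall j, lam * b1 j + mu * b3 j = (lam + mu) * b2 j)%N -> b1 = b2.
Proof.
move=> lam0 mu0 e1 e2 e3 lin.
pose c (b : {ffun 'I_n -> 'I_D}) j : int := (b j : nat)%:Z.
have sq (b : {ffun 'I_n -> 'I_D}) : (\sum_j b j ^ 2 = r)%N -> \sum_j c b j ^+ 2 = r%:Z.
  by move=> <-; rewrite -[RHS]natz natr_sum; apply: eq_bigr => j _; rewrite natrX natz.
have linz j : lam%:Z * c b1 j + mu%:Z * c b3 j = (lam%:Z + mu%:Z) * c b2 j.
  by have := congr1 Posz (lin j); rewrite PoszD !PoszM PoszD.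
(* Up to the factor [lam * mu], the squared distance of [b1] and [b3] is [(lam + mu) * (lam * |b1|^2
   + mu * |b3|^2) - (lam + mu)^2 * |b2|^2], which vanishes for equal norms. *)
have : \sum_j (lam * mu)%:Z * (c b1 j - c b3 j) ^+ 2 = 0.
  transitivity (\sum_j ((lam%:Z + mu%:Z) * lam%:Z * c b1 j ^+ 2 +
     (lam%:Z + mu%:Z) * mu%:Z * c b3 j ^+ 2 - (lam%:Z + mu%:Z)^+2 * c b2 j ^+ 2)).
    by apply: eq_bigr => j _; rewrite -exprMn -linz PoszM; ring.
  by rewrite !big_split /= sumrN -!mulr_sumr !sq //; ring.
move/psumr_eq0P => z.
have {}z := z (fun j _ => mulr_ge0 (isT : 0 <= (lam * mu)%:Z) (sqr_ge0 _)).
apply/ffunP => j; apply/val_inj.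
have /eqP := z j isT; rewrite mulf_eq0 sqrf_eq0 subr_eq0 => /orP[|/eqP e13].
  by rewrite eqz_nat muln_eq0; lia.
have := lin j; have -> : b3 j = b1 j :> nat by case: e13.
rewrite -mulnDl => /eqP; rewrite eqn_pmul2l; first by move/eqP.
by rewrite addn_gt0 lam0.
Qed.

(** Each coordinate is [q * b + x], with [b] on a sphere and [x < h] a position in a small box. The
    sizes exclude both wrapping modulo [p] and carries from [x] to [b], so the equation in ['F_p]
    descends to the sphere, where convexity gives [b1 = b2]. Thus [T] need only contain pairs from a
    common box. *)
Lemma behrend_Fp (p lam mu n D : nat) :
  prime p -> (0 < lam)%N -> (0 < mu)%N -> (0 < n)%N -> (0 < D)%N ->
  ((lam + mu) ^ 2 * D <= p)%N ->
  exists (S : {set 'rV['F_p]_n}) (T : {set 'rV['F_p]_n * 'rV['F_p]_n}),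
  [/\ (p ^ n <= #|S| * (n * D ^ 2 * (2 * (lam + mu) ^ 2) ^ n))%N,
      (#|T| * D ^ n <= p ^ (n + n))%N
    & forall s1 s2 s3, s1 \in S -> s2 \in S -> s3 \in S ->
        lam%:R *: s1 + mu%:R *: s3 = (lam + mu)%:R *: s2 -> (s1, s2) \in T].
Proof.
move=> pp lam0 mu0 n0 D0 Dp.
have [r hr] := sphere_pigeonhole n0 D0.
set B := [set _ | _] in hr.
set L := (lam + mu)%N in Dp *.
have L0 : (0 < L)%N by rewrite /L; lia.
(* The largest box side with [L * (q * D) <= p], where [q = L * h]: the inner [L] leaves room for
   [lam * x1 + mu * x3 < q], the outer one keeps [L] times a coordinate below [p]. Rounding down
   loses at most a factor 2. *)
pose h := (p %/ (L ^ 2 * D))%N.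
have LD0 : (0 < L ^ 2 * D)%N by rewrite muln_gt0 expn_gt0 L0.
have hp : (L ^ 2 * D * h <= p)%N by rewrite mulnC leq_divM.
have h0 : (0 < h)%N by rewrite divn_gt0.
have ph : (p <= 2 * (L ^ 2 * D * h))%N.
  have := ltn_ceil p LD0; rewrite -/h => /ltnW ph.
  apply: (leq_trans ph).
  by rewrite mulnC mulnCA leq_pmul2l // mul2n -addnn -addn1 leq_add2l.
pose q := (L * h)%N.
have q0 : (0 < q)%N by rewrite muln_gt0 L0.
pose num (b : {ffun 'I_n -> 'I_D}) (x : {ffun 'I_n -> 'I_h}) j := (q * b j + x j)%N.
have num_lt b x j : (L * num b x j < p)%N.
  apply: leq_trans hp; rewrite /num.
  have -> : (L ^ 2 * D * h = L * (q * D))%N by rewrite /q; lia.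
  rewrite ltn_pmul2l //.
  apply: (@leq_trans (q * (b j).+1)%N); last by rewrite leq_pmul2l.
  rewrite mulnS addnC ltn_add2r; apply: leq_trans (ltn_ord _) _.
  by rewrite /q leq_pmull.
pose enc (b : {ffun 'I_n -> 'I_D}) (x : {ffun 'I_n -> 'I_h}) : 'rV['F_p]_n :=
  \row_j (num b x j)%:R.
have enc_inj : injective (fun z => enc z.1 z.2).
  move=> [b x] [b' x'] /rowP e.
  have E j : num b x j = num b' x' j.
    have := congr1 val (e j); rewrite !mxE /= !val_Fp_nat // !modn_small //.
      by apply: leq_ltn_trans (num_lt b' x' j); rewrite leq_pmull.
    by apply: leq_ltn_trans (num_lt b x j); rewrite leq_pmull.
  have xq (z : {ffun 'I_n -> 'I_h}) j : (z j < q)%N.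
    by apply: leq_trans (ltn_ord _) _; rewrite leq_pmull.
  congr pair; apply/ffunP => j; apply/val_inj.
    have := congr1 (divn^~ q) (E j).
    by rewrite /num !(mulnC q) !divnMDl // !divn_small ?addn0.
  have := congr1 (modn^~ q) (E j).
  by rewrite /num !(mulnC q) !modnMDl // !modn_small.
pose S := [set enc z.1 z.2 | z in finset.setX B [set: {ffun 'I_n -> 'I_h}]].
pose T := [set (enc z.1 z.2.1, enc z.1 z.2.2) |
  z : {ffun 'I_n -> 'I_D} * ({ffun 'I_n -> 'I_h} * {ffun 'I_n -> 'I_h})].
exists S, T; split.
- rewrite card_imset // cardsX cardsT card_ffun !card_ord.
  apply: leq_trans (_ : (D ^ n * (h ^ n * (2 * L ^ 2) ^ n) <= _)%N).
    rewrite -!expnMn leq_exp2r //; apply: (leq_trans ph); lia.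
  have -> : (#|B| * h ^ n * (n * D ^ 2 * (2 * L ^ 2) ^ n) =
     #|B| * (n * D ^ 2) * (h ^ n * (2 * L ^ 2) ^ n))%N by lia.
  by rewrite leq_mul2r hr orbT.
- apply: (@leq_trans (D ^ n * (h ^ n * h ^ n) * D ^ n)).
    rewrite leq_mul2r; apply/orP; right; apply: leq_trans (leq_imset_card _ _) _.
    by rewrite !card_prod !card_ffun !card_ord.
  have Dh : (D * h <= p)%N.
    by apply: leq_trans hp; rewrite -mulnA leq_pmull // expn_gt0 L0.
  rewrite expnD; apply: leq_trans (_ : ((D * h) ^ n * (D * h) ^ n <= _)%N).
    by rewrite !expnMn; lia.
  by apply: leq_mul; rewrite leq_exp2r.
move=> _ _ _ /imsetP[[b1 x1] /[!inE] /andP[/eqP B1 _] ->]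
  /imsetP[[b2 x2] /[!inE] /andP[/eqP B2 _] ->]
  /imsetP[[b3 x3] /[!inE] /andP[/eqP B3 _] ->] /= /rowP e.
have num_eq j : (lam * num b1 x1 j + mu * num b3 x3 j = L * num b2 x2 j)%N.
  have := congr1 val (e j).
  rewrite !mxE -!natrM -natrD /= !val_Fp_nat // !modn_small //.
  have := num_lt b1 x1 j; have := num_lt b3 x3 j; rewrite /L; nia.
suff b12 : b1 = b2 by apply/imsetP; exists (b2, (x1, x2)); rewrite //= b12.
apply: (sphere_convex lam0 mu0 B1 B2 B3) => j.
have := num_eq j; rewrite /num.
have -> : (lam * (q * b1 j + x1 j) + mu * (q * b3 j + x3 j) =
   (lam * b1 j + mu * b3 j) * q + (lam * x1 j + mu * x3 j))%N by lia.
have -> : (L * (q * b2 j + x2 j) = L * b2 j * q + L * x2 j)%N by lia.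
move/(congr1 (divn^~ q)); rewrite !divnMDl // !divn_small ?addn0 //.
  by rewrite ltn_pmul2l.
have := ltn_ord (x1 j); have := ltn_ord (x3 j); rewrite /q /L; nia.
Qed.

(** * The random construction over a prime field *)

(** The [#|F|] translates of the hyperplane along a basis vector on which [w] does not vanish are
    pairwise disjoint. *)
Lemma card_hyperplane_le (F : finFieldType) (r : nat) (w : 'cV[F]_r) (i : F) :
  w != 0 -> (#|[set x : 'rV[F]_r | ((x *m w) 0 0 == i)%R]| * #|F| <= #|F| ^ r)%N.
Proof.
move=> w0; have [j wj] : exists j, w j 0 != 0.
  apply/existsP; apply: contraNT w0 => /existsPn h; apply/eqP/colP => j.
  by rewrite mxE; apply/eqP; have := h j; rewrite negbK.
set B := [set _ | _].
pose f (z : 'rV[F]_r * F) := z.1 + z.2 *: delta_mx 0 j.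
have fw z : (f z *m w) 0 0 = (z.1 *m w) 0 0 + z.2 * w j 0.
  by rewrite mulmxDl -scalemxAl -rowE !mxE.
have -> : (#|B| * #|F| = #|f @: finset.setX B [set: F]|)%N.
  rewrite card_in_imset ?cardsX ?cardsT //.
  move=> [x c] [x' c'] /[!inE] /andP[/= /eqP xi _] /andP[/= /eqP xi' _] e.
  have := congr1 (fun y => (y *m w) 0 0) e; rewrite !fw /= xi xi'.
  move=> /addrI /(mulIf wj) cc; rewrite /f /= cc in e *.
  by congr pair; apply: addIr e.
by apply: leq_trans (max_card _) _; rewrite card_mx mul1n.
Qed.

(** Here [u2] and [u3] stand for the differences [y2 - y1] and [y3 - y1] modulo [p]. As [w] kills
    both, the three points of a pattern share one random pair, and [l] places their images in [S] on
    a solution of the equation of [behrend_Fp]. *)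
Lemma exists_Fp_set (R : realType) (p r lam mu n D : nat) (w l : 'cV['F_p]_r)
    (u2 u3 : 'rV['F_p]_r) (al : R) :
  let bt : R := (D%:R ^+ n)^-1 in
  prime p -> (0 < lam)%N -> (0 < mu)%N -> (0 < n)%N -> (0 < D)%N ->
  ((lam + mu) ^ 2 * D <= p)%N -> (mu < p)%N ->
  w != 0 -> u2 *m w = 0 -> u3 *m w = 0 ->
  (u2 *m l) 0 0 = mu%:R -> (u3 *m l) 0 0 = (lam + mu)%:R -> 0 <= al ->
  al + p%:R * expR (- (bt * p%:R)) <=
    ((n * D ^ 2 * (2 * (lam + mu) ^ 2) ^ n)%:R)^-1 ->
  exists A : {set 'rV['F_p]_r}, al * p%:R ^+ r <= #|A|%:R /\
    forall e : 'F_p, e != 0 ->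
      #|[set x | [&& x \in A, x + e *: u2 \in A & x + e *: u3 \in A]]|%:R
        <= 4 * bt * p%:R ^+ r.
Proof.
move=> bt pp lam0 mu0 n0 D0 Dp mup w0 u2w u3w u2l u3l al0 hal.
have [S [T [Scard Tcard ST]]] := behrend_Fp pp lam0 mu0 n0 D0 Dp.
set C := (n * D ^ 2 * _)%N in Scard hal.
have p0 : (0 < p)%N by exact: prime_gt0.
have p0' : 0 < p%:R :> R by rewrite ltr0n.
have r0 : (0 < r)%N.
  rewrite lt0n; apply: contraNneq w0 => r0; apply/eqP/colP => -[j jr].
  by exfalso; rewrite r0 in jr.
pose Om := ('rV['F_p]_n * 'rV['F_p]_n)%type.
have cardV m : #|'rV['F_p]_m| = (p ^ m)%N by rewrite card_mx mul1n card_Fp.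
have cardOm : #|{: Om}| = (p ^ n * p ^ n)%N by rewrite card_prod !cardV.
pose G (x : 'rV['F_p]_r) : {set Om} :=
  [set o | (x *m l) 0 0 *: o.1 + o.2 \in S].
pose H (e : {e : 'F_p | e != 0}) x : {set Om} :=
  [set o | [&& o \in G x, o \in G (x + val e *: u2) & o \in G (x + val e *: u3)]].
pose tau (x : 'rV['F_p]_r) : 'F_p := (x *m w) 0 0.
have tau2 x e : tau (x + e *: u2) = tau x.
  by rewrite /tau mulmxDl -scalemxAl u2w scaler0 addr0.
have tau3 x e : tau (x + e *: u3) = tau x.
  by rewrite /tau mulmxDl -scalemxAl u3w scaler0 addr0.
have Gcard x : #|G x| = (p ^ n * #|S|)%N.
  have -> : G x = (fun z => (z.1, z.2 - (x *m l) 0 0 *: z.1)) @: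
      finset.setX [set: 'rV['F_p]_n] S.
    apply/finset.setP => -[t f]; rewrite inE /=; apply/idP/imsetP => [h|[[t' f']]].
      by exists (t, (x *m l) 0 0 *: t + f); rewrite ?inE //= addrAC subrr add0r.
    by rewrite !inE /= => f'S [-> ->]; rewrite addrC subrK.
  rewrite card_imset ?cardsX ?cardsT ?cardV //.
  by move=> -[t f] [t' f'] /= [-> /addIr ->].
(* The pair [(theta, phi)] is recovered from the images of the first two points, because [e * mu] is
   invertible modulo [p]; these images form a pair in [T]. *)
have Hcard e x : (#|H e x| <= #|T|)%N.
  have en0 : val e * mu%:R != 0 :> 'F_p.
    rewrite mulf_neq0 ?(valP e) // -val_eqE /= val_Fp_nat // modn_small //.
    by rewrite -lt0n.
  pose ll := (x *m l) 0 0.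
  pose f (o : Om) := (ll *: o.1 + o.2, (ll + val e * mu%:R) *: o.1 + o.2).
  have finj : injective f.
    move=> [t g] [t' g'] [/= e1 e2].
    have : (val e * mu%:R) *: t = (val e * mu%:R) *: t'.
      move: e2; rewrite !scalerDl addrAC e1 -[RHS]addrAC; exact: addrI.
    by move/(scalerI en0) => tt; congr pair => //; move: e1; rewrite tt => /addrI.
  rewrite -(card_imset _ finj); apply: subset_leq_card; apply/fintype.subsetP.
  move=> _ /imsetP[[t g] + ->]; rewrite !inE !mulmxDl -!scalemxAl /=.
  rewrite ![fun_of_matrix (_ + _) _ _]mxE ![fun_of_matrix (_ *: _) _ _]mxE u2l u3l.
  move=> /and3P[h1 h2 h3]; apply: (ST _ _ _ h1 h2 h3).
  rewrite -/ll !scalerDr !scalerA addrACA -!scalerDl; congr (_ *: _ + _ *: _).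
    by rewrite natrD; ring.
  by rewrite natrD.
have cE : #|'rV['F_p]_r|%:R = p%:R ^+ r :> R by rewrite cardV natrX.
have cO : #|{: Om}|%:R = p%:R ^+ n * p%:R ^+ n :> R by rewrite cardOm natrM !natrX.
have C0 : (0 < C)%N by rewrite !muln_gt0 n0 !expn_gt0 D0 muln_gt0 expn_gt0 addn_gt0 lam0.
have D0' : 0 < D%:R ^+ n :> R by rewrite exprn_gt0 // ltr0n.
have bt0 : 0 < bt by rewrite invr_gt0.
(* Fibres of [tau] have at most [p ^ r.-1] points. The deviation [s = bt * p] equals the bound on
   the mean, whence the constant [4 = 2 * 2] in the conclusion. *)
have [] := @random_choice R 'F_p Om 'rV['F_p]_r {e : 'F_p | e != 0} tau G H
   (p ^ r.-1) (C%:R^-1) bt (bt * p%:R) al.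
- by rewrite expn_gt0 p0.
- by rewrite cardV expn_gt0 p0.
- by rewrite cardOm muln_gt0 expn_gt0 p0.
- by [].
- exact: ltW.
- move=> i; have := card_hyperplane_le i w0; rewrite card_Fp //.
  have -> : (p ^ r = p ^ r.-1 * p)%N by rewrite -expnSr prednK.
  by rewrite leq_pmul2r.
- move=> x; rewrite Gcard cO ler_pdivrMl ?ltr0n // natrM natrX mulrCA.
  by rewrite ler_pM2l ?exprn_gt0 // -natrX -natrM ler_nat mulnC.
- move=> e x; rewrite cO ler_pdivlMl // -exprD -!natrX -natrM ler_nat mulnC.
  by apply: leq_trans Tcard; rewrite leq_mul2r Hcard orbT.
- apply: le_trans hal; rewrite lerD2l ler_pM2r ?expR_gt0 // ler_nat.
  by rewrite card_sig; apply: leq_trans (max_card _) _; rewrite card_Fp.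
move=> om [omG omH]; exists [set x | om (tau x) \in G x]; split.
  by rewrite -cE.
move=> e e0; have := omH (exist _ e e0).
rewrite card_Fp // (_ : 2 * _ * _ = 4 * bt * p%:R ^+ r); last first.
  have -> : p%:R ^+ r = p%:R * p%:R ^+ r.-1 :> R by rewrite -exprS prednK.
  by rewrite natrX; ring.
apply: le_trans; rewrite ler_nat; apply: subset_leq_card; apply/fintype.subsetP => x.
by rewrite !inE !tau2 !tau3.
Qed.

(** * Linear forms separating the pattern or constant on it *)

Lemma exists_nonroot (q : {poly int}) : q != 0 -> exists x : int, ~~ root q x.
Proof.
move=> q0; apply: contrapT => /forallNP h.
have := @max_poly_roots _ q [seq Posz i | i <- iota 0 (size q)] q0.
rewrite size_map size_iota ltnn => /(_ _ _)/negP []; last by [].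
  by apply/allP => x _; have /negP := h x; rewrite negbK.
by rewrite map_inj_uniq ?iota_uniq // => i j [].
Qed.

(* The form is a row of Vandermonde type, [i |-> x ^ i]. *)
Lemma exists_separating_form (r : nat) (s : seq 'rV[int]_r) :
  (forall v, v \in s -> v != 0) ->
  exists l : 'cV[int]_r, forall v, v \in s -> (v *m l) 0 0 != 0.
Proof.
move=> s0.
(* Evaluating [rVpoly v] at [x] applies the Vandermonde form to [v], so one nonroot of the product
   handles all of [s]. *)
have q0 : \prod_(v <- s) rVpoly v != 0.
  rewrite prodf_seq_neq0; apply/allP => v vs /=.
  apply: contra (s0 v vs) => /eqP e; apply/eqP.
  by rewrite -[v]rVpolyK e linear0.
have [x] := exists_nonroot q0; rewrite /root horner_prod prodf_seq_neq0.
move=> /allP h; exists (\col_i x ^+ i) => v /h /=.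
rewrite horner_poly mxE; under eq_bigr do rewrite valK.
by under [X in _ -> X != 0]eq_bigr do rewrite mxE.
Qed.

Lemma exists_sorted_triple (T : choiceType) (P : {fset T}) (f : T -> int) (a b c : T) :
  a \in P -> b \in P -> c \in P -> f a != f b -> f a != f c -> f b != f c ->
  exists x y z, [/\ x \in P, y \in P & z \in P] /\ f x < f y < f z.
Proof.
move=> aP bP cP.
case: (ltgtP (f a) (f b)) => // ab _; case: (ltgtP (f a) (f c)) => // ac _;
  case: (ltgtP (f b) (f c)) => // bc _.
- by exists a, b, c; rewrite ab bc.
- by exists a, c, b; rewrite ac bc.
- by exfalso; lia.
- by exists c, a, b; rewrite ac ab.
- by exists b, a, c; rewrite ac ab.
- by exfalso; lia.
- by exists b, c, a; rewrite ac bc.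
- by exists c, b, a; rewrite ab bc.
Qed.

(** A form that is nonzero on the differences of three distinct points orders them strictly; the
    gaps [mu] and [lam] become the coefficients of the Behrend equation. *)
Lemma exists_separated_triple (r : nat) (P : {fset 'rV[int]_r}) : (3 <= #|` P|)%N ->
  exists (y1 y2 y3 : 'rV[int]_r) (l : 'cV[int]_r) (lam mu : nat),
  [/\ [/\ y1 \in P, y2 \in P & y3 \in P], (0 < lam)%N, (0 < mu)%N,
      ((y2 - y1) *m l) 0 0 = mu%:Z & ((y3 - y1) *m l) 0 0 = (lam + mu)%:Z].
Proof.
move=> P3.
have [a [b [c [aP [bP cP] [ab ac bc]]]]] : exists a b c,
    [/\ a \in P, b \in P /\ c \in P & [/\ a != b, a != c & b != c]].
  have mP x : (x \in enum_fset P) = (x \in P) by [].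
  case: (enum_fset P) (fset_uniq P) P3 mP => [|a [|b [|c s]]] //= u _ mP.
  exists a, b, c; rewrite -!mP !inE !eqxx !orbT; split => //.
  by move: u; rewrite !inE !negb_or => /and4P[/and3P[-> -> _] /andP[-> _] _ _].
have [l hl] : exists l : 'cV[int]_r,
    forall v, v \in [:: a - b; a - c; b - c] -> (v *m l) 0 0 != 0.
  apply: exists_separating_form => v; rewrite !inE.
  by case/or3P => /eqP ->; rewrite subr_eq0.
pose f (y : 'rV[int]_r) := (y *m l) 0 0.
have fB x y : ((x - y) *m l) 0 0 = f x - f y.
  by rewrite mulmxBl [LHS]mxE [X in _ + X = _]mxE.
have fn x y : x - y \in [:: a - b; a - c; b - c] -> f x != f y.
  by move/hl; rewrite fB subr_eq0.
have [x [y [z [[xP yP zP] /andP[xy yz]]]]] := exists_sorted_triple aP bP cP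
  (fn a b (mem_head _ _)) (fn a c ltac:(by rewrite !inE eqxx orbT))
  (fn b c ltac:(by rewrite !inE eqxx !orbT)).
exists x, y, z, l, `|f z - f y|%N, `|f y - f x|%N; rewrite !fB.
by split => //; lia.
Qed.

(** The rows lie in the direction space of dimension [k < r], whereas an invertible matrix would
    have rows spanning everything. Stated over the integers, the vanishing survives reduction modulo
    any [p]. *)
Lemma det_affine_dim_lt (R : realType) (r k : nat) (P : {fset 'rV[int]_r})
    (y : 'I_r -> 'rV[int]_r) (y0 : 'rV[int]_r) :
  has_affine_dim R P k -> (k < r)%N -> y0 \in P -> (forall i, y i \in P) ->
  \det (\matrix_i (y i - y0)) = 0.
Proof.
move=> [v [U [PU _ dU]]] kr y0P yP.
set B := \matrix_i _.
have inU z : z \in P -> map_mx intr (z - y0) \in U.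
  move=> zP; have [a /= aU ea] := PU _ (ex_intro2 _ _ z zP erefl).
  have [b /= bU eb] := PU _ (ex_intro2 _ _ y0 y0P erefl).
  rewrite map_mxB -ea -eb (_ : _ - _ = a - b) ?memvB //.
  by rewrite opprD addrACA subrr add0r.
apply/eqP; rewrite -(intr_eq0 R) -det_map_mx; apply/negPn/negP => detB.
have uB : (map_mx intr B : 'M[R]_r) \in unitmx by rewrite unitmxE unitfE.
suff full : (fullv <= U)%VS.
  by have := dimvS full; rewrite dU dimvf /dim /= mul1n leqNgt kr.
apply/subvP => x _; rewrite -(mulmxKV uB x) mulmx_sum_row.
by apply: memv_suml => i _; rewrite memvZ // -map_row rowK inU.
Qed.

Lemma exists_Fp_conormal (R : realType) (r k p : nat) (P : {fset 'rV[int]_r})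
    (y1 y2 y3 : 'rV[int]_r) :
  has_affine_dim R P k -> (k < r)%N -> y1 \in P -> y2 \in P -> y3 \in P ->
  y1 != y2 ->
  exists w : 'cV['F_p]_r, [/\ w != 0, map_mx intr (y2 - y1) *m w = 0 &
    map_mx intr (y3 - y1) *m w = 0].
Proof.
move=> hP kr y1P y2P y3P y12.
(* Row 0 is [y2 - y1] and every other row is [y3 - y1]; a kernel vector of this matrix modulo [p] is
   the required [w]. *)
pose y (i : 'I_r) := if val i == 0 then y2 else y3.
have yP i : y i \in P by rewrite /y; case: ifP.
have d0 := det_affine_dim_lt hP kr y1P yP.
have /eqP : \det (map_mx intr (\matrix_i (y i - y1)) : 'M['F_p]_r)^T = 0.
  by rewrite det_tr det_map_mx d0.
move=> /det0P[v v0 /(congr1 trmx)]; rewrite trmx_mul trmxK trmx0 => vB.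
exists v^T; rewrite -(inj_eq (@trmx_inj _ _ _)) trmxK trmx0; split => //.
- have r0 : (0 < r)%N by apply: leq_ltn_trans kr.
  have := congr1 (row (Ordinal r0)) vB.
  by rewrite row_mul -map_row rowK row0.
(* For [r = 1] there is no second row, but then the zero determinant is [y2 - y1] itself,
   contradicting [y1 != y2]. *)
- have [r1|r1] := leqP r 1; last first.
    have := congr1 (row (Ordinal r1)) vB.
    by rewrite row_mul -map_row rowK row0.
  exfalso; move: y12; rewrite eq_sym -subr_eq0 => /eqP[]; apply/rowP => j.
  have r1' : r = 1%N by lia.
  move: d0; clear -r1'; subst r; rewrite det_mx11 !mxE => d0.
  by rewrite (ord1 j) -[RHS]d0.
Qed.

(** * Transfer from the prime field to the integer box *)

(** Taking representatives in [1..p] turns [A'] into a subset of the box, and integer patterns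
    reduce to patterns modulo [p]. A nonzero [d] divisible by [p] is too long to fit in the box, so
    it gives no pattern. *)
Lemma lift_Fp_set (r p : nat) (P : {fset 'rV[int]_r}) (y1 y2 y3 : 'rV[int]_r)
    (A' : {set 'rV['F_p]_r}) :
  prime p -> y1 \in P -> y2 \in P -> y3 \in P -> y1 != y2 ->
  exists A : {fset 'rV[int]_r}, [/\ forall x, x \in A -> in_box p x,
    #|` A| = #|A'| &
    forall d : int, d != 0 -> pattern_count P A d = 0%N \/
      exists2 e : 'F_p, e != 0 & (pattern_count P A d <=
      #|[set x | [&& x \in A', (x + e *: map_mx intr (y2 - y1))%R \in A' &
         (x + e *: map_mx intr (y3 - y1))%R \in A']]|)%N].
Proof.
move=> pp y1P y2P y3P y12.
have val_lt (a : 'F_p) : (a < p)%N by rewrite -[X in (_ < X)%N](Fp_cast pp) ltn_ord.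
pose g (v : 'rV['F_p]_r) : 'rV[int]_r := \row_i (v 0 i : nat).+1%:Z.
pose f (x : 'rV[int]_r) : 'rV['F_p]_r := map_mx intr x - const_mx 1.
have fg : cancel g f.
  move=> v; apply/rowP => i; rewrite !mxE -pmulrn -natr1 addrK.
  by rewrite -[RHS]natr_Zp.
have fD x y : f (x + y) = f x + map_mx intr y.
  by rewrite /f map_mxD addrAC.
have g_inj := can_inj fg.
exists [fset g v | v in A']; split.
- by move=> _ /imfsetP[v _ ->] i; rewrite mxE !lez_nat val_lt.
- by rewrite card_imfset //= -cardE.
move=> d d0; rewrite /pattern_count.
have P0 : P != fset0 by apply/fset0Pn; exists y1.
have fin := finite_pattern_set [fset g v | v in A'] d P0.
set X := pattern_set _ _ _ in fin *.
have XP x : x \in fset_set X -> forall y, y \in P ->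
    exists2 v, v \in A' & x + d *: y = g v.
  rewrite in_fset_set // inE => xX y yP; have /imfsetP[v vA ->] := xX y yP.
  by exists v.
have [->|/fset0Pn[x0 x0X]] := eqVneq (fset_set X) fset0.
  by left; rewrite cardfs0.
right; exists d%:~R.
  have [v1 _ e1] := XP _ x0X _ y1P; have [v2 _ e2] := XP _ x0X _ y2P.
  have [j yj] : exists j, y1 0 j != y2 0 j.
    apply/existsP; apply: contraNT y12 => /existsPn h; apply/eqP/rowP => j.
    by apply/eqP; have := h j; rewrite negbK.
  have := congr1 (fun z : 'rV_r => z 0 j) e1.
  have := congr1 (fun z : 'rV_r => z 0 j) e2.
  rewrite !mxE => E2 E1.
  have := val_lt (v1 0 j); have := val_lt (v2 0 j) => L2 L1.
  (* In a coordinate where [y1] and [y2] differ, [d * (y2 - y1)] is a difference of two residues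
     below [p]. *)
  have dp : (absz d < p)%N.
    have : d * (y2 0 j - y1 0 j) = (v2 0 j : nat)%:Z - (v1 0 j : nat)%:Z.
      have aux (a b c : int) (m n : nat) :
          a + b = m.+1%:Z -> a + c = n.+1%:Z -> c - b = n%:Z - m%:Z by lia.
      by rewrite mulrBr; exact: aux E1 E2.
    move=> dE; have : (absz d <= absz (d * (y2 0 j - y1 0 j))%R)%N.
      by rewrite abszM leq_pmulr // absz_gt0 subr_eq0 eq_sym.
    rewrite dE => dle; apply: leq_ltn_trans dle _; lia.
  have absd : ((absz d)%:R : 'F_p) != 0.
    by rewrite -val_eqE /= val_Fp_nat // modn_small // absz_eq0.
  case: d d0 {X fin XP x0X e1 e2 E1 E2 dp} absd => n // _.
  by rewrite NegzE mulrNz oppr_eq0.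
set B := [set _ | _].
(* A pattern position [x] is determined by the residue [v1] of its point [x + d *: y1]. *)
apply: (@leq_trans #|` [fset g v - d *: y1 | v in B]|); last first.
  by rewrite card_imfset //= ?cardE // => v v' /addIr /g_inj.
apply: fsubset_leq_card; apply/fsubsetP => x xX.
have [v1 v1A e1] := XP _ xX _ y1P; have [v2 v2A e2] := XP _ xX _ y2P.
have [v3 v3A e3] := XP _ xX _ y3P.
apply/imfsetP; exists v1; last by rewrite -e1 addrK.
have sh y v : x + d *: y = g v -> v1 + d%:~R *: map_mx intr (y - y1) = v.
  move=> e; rewrite -[v]fg -e -[v1]fg -e1.
  have -> : x + d *: y = x + d *: y1 + d *: (y - y1).
    by rewrite scalerBr -addrA [_ + (_ - _)]addrC subrK.
  by rewrite [in RHS]fD map_mxZ.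
by rewrite inE (sh _ _ e2) (sh _ _ e3) v1A v2A v3A.
Qed.

(** * Upper bounds for the popular difference density *)

(** The density is attained and its definition concerns all large [N], so counterexamples along an
    unbounded set of [N], such as the primes, bound it. *)
Lemma pdd_le (R : realType) (r : nat) (P : {fset 'rV[int]_r}) (al q : R) :
  P != fset0 -> 0 < al < 1 ->
  (forall N0, exists2 N, (N0 < N)%N & exists A : {fset 'rV[int]_r},
    [/\ forall x, x \in A -> in_box N x, al * N%:R ^+ r <= #|` A|%:R &
      forall d, d != 0 -> (pattern_count P A d)%:R <= q * N%:R ^+ r]) ->
  pdd P al <= q.
Proof.
move=> P0 al01 hq; rewrite leNgt; apply/negP => qlt.
have [/(_ ((pdd P al - q) / 2)) + _] := pdd_max P0 al01.
case=> [|N0 hN]; first by rewrite divr_gt0 // subr_gt0.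
have [N N0N [A [Abox Acard Apat]]] := hq N0.
have [d [d0 hd]] := hN N (ltnW N0N) A Abox Acard.
have := le_trans hd (Apat d d0).
have NN : 0 < N%:R ^+ r :> R by rewrite exprn_gt0 // ltr0n (leq_ltn_trans _ N0N).
by rewrite ler_pM2r //; lra.
Qed.

(** Any set of half the box works, since patterns are no more numerous than the points of the set.
    This covers the [alpha] for which the Behrend bound says nothing. *)
Lemma pdd_le_half (R : realType) (r : nat) (P : {fset 'rV[int]_r}) (al : R) :
  P != fset0 -> (0 < r)%N -> 0 < al < 1 / 2 -> pdd P al <= 1 / 2.
Proof.
move=> P0 r0 /andP[al0 al1]; apply: pdd_le => //; first by apply/andP; lra.
(* An even side makes [N ^ r] even, so that half of the box is exact. *)
move=> N0; exists (N0.+1 * 2)%N; first by lia.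
set N := (N0.+1 * 2)%N.
have [B Bbox Bcard] := box_ex r N.
have N2 : (N ^ r = 2 * (N ^ r)./2)%N.
  by rewrite mul2n -[LHS]odd_double_half oddX /N oddM andbF orbF; case: (r) r0.
pose m := (N ^ r)./2; pose A := seq_fset tt (take m (enum_fset B)).
have Acard : #|` A| = m.
  rewrite size_seq_fset undup_id ?take_uniq ?fset_uniq // size_takel //.
  by rewrite [X in (_ <= X)%N]Bcard N2 leq_pmull.
have NE : N%:R ^+ r = 2 * m%:R :> R by rewrite -natrX N2 natrM.
have m0 : 0 <= m%:R :> R by [].
exists A; split.
- by move=> x; rewrite seq_fsetE => /mem_take xB; apply/Bbox.
- by rewrite Acard NE; nra.
- move=> d _; apply: le_trans (_ : #|` A|%:R <= _).
    by rewrite ler_nat pattern_count_le.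
  by rewrite Acard NE; lra.
Qed.

(** Squaring [1 + x / 2 <= expR (x / 2)] suffices; quadratic decay already beats the factor [p] from
    the union over differences. *)
Lemma expRN_le_invsqr (R : realType) (x : R) : 0 < x -> expR (- x) <= 4 / x ^+ 2.
Proof.
move=> x0; rewrite expRN -[leRHS]invrK.
rewrite lef_pV2 ?posrE ?expR_gt0 ?invr_gt0 ?divr_gt0 ?exprn_gt0 //.
rewrite invf_div.
have h : 1 + x / 2 <= expR (x / 2) by exact: expR_ge1Dx.
have -> : expR x = expR (x / 2) ^+ 2 by rewrite expr2 -expRD -splitr.
have e0 := expR_ge0 (x / 2); nra.
Qed.

Lemma pdd_le_behrend (R : realType) (r k : nat) (P : {fset 'rV[int]_r}) :
  (3 <= #|` P|)%N -> has_affine_dim R P k -> (k < r)%N ->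
  exists2 C : nat, (0 < C)%N & forall (n : nat) (al : R), (0 < n)%N ->
    0 < al -> al * 2 * 2 ^+ (C * n) <= 1 -> pdd P al <= 4 / 2 ^+ (n ^ 2).
Proof.
move=> P3 hP kr.
have [y1 [y2 [y3 [l [lam [mu [[y1P y2P y3P] lam0 mu0 l2 l3]]]]]]] :=
  exists_separated_triple P3.
have y12 : y1 != y2.
  by apply: contraTneq mu0 => e; move: l2; rewrite e subrr mul0mx mxE => -[<-].
(* With [D = 2 ^ n], the factors of the inverse density obey [n <= 2 ^ n], [D ^ 2 = 2 ^ (2 * n)] and
   [2 * L ^ 2 <= 2 ^ (2 * L ^ 2)]. *)
pose L := (lam + mu)%N; exists (3 + 2 * L ^ 2)%N => // n al n0 al0 hal.
have P0 : P != fset0 by apply/fset0Pn; exists y1.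
pose D := (2 ^ n)%N.
pose C := (n * D ^ 2 * (2 * L ^ 2) ^ n)%N.
have D0 : (0 < D)%N by rewrite expn_gt0.
have L0 : (0 < L)%N by rewrite addn_gt0 lam0.
have C0 : (0 < C)%N by rewrite !muln_gt0 n0 !expn_gt0 muln_gt0 expn_gt0 L0.
have CD : (C <= 2 ^ ((3 + 2 * L ^ 2) * n))%N.
  rewrite mulnDl expnD; apply: leq_mul; last first.
    by rewrite expnM leq_exp2r // ltnW // ltn_expl.
  rewrite mulSn expnD; apply: leq_mul; first by rewrite ltnW // ltn_expl.
  by rewrite /D -expnM mulnC.
have bD : D%:R ^+ n = 2 ^+ (n ^ 2) :> R.
  by rewrite /D natrX -exprM.
have alC : al * 2 * C%:R <= 1.
  apply: le_trans hal; rewrite ler_pM2l ?mulr_gt0 //.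
  by rewrite -natrX ler_nat.
have C1 : 1 <= C%:R :> R by rewrite ler1n.
apply: pdd_le => //; first by rewrite al0 /=; nra.
(* The prime must exceed [N0], leave room for the Behrend set, and make [p * expR (- (bt * p))] at
   most [(2 * C)^-1], half of the available density; [al] takes the other half. *)
move=> N0; have [p] := prime_above (N0 + L ^ 2 * D + 8 * C * D ^ (2 * n)).
have lt3 (a b c q : nat) :
    (a + b + c < q)%N -> [/\ (a < q)%N, (b <= q)%N & (c <= q)%N].
  by clear=> h; split; lia.
move=> /lt3[hN hL hCp] pp; exists p => //.
have [w [w0 w2 w3]] := exists_Fp_conormal p hP kr y1P y2P y3P y12.
pose m2 : 'rV['F_p]_r := map_mx intr (y2 - y1).
pose m3 : 'rV['F_p]_r := map_mx intr (y3 - y1).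
have pp0 : 0 < p%:R :> R by rewrite ltr0n prime_gt0.
have [] := @exists_Fp_set R p r lam mu n D w (map_mx intr l) m2 m3 al
  pp lam0 mu0 n0 D0 _ _ w0 w2 w3.
- exact: hL.
- have : (L <= L ^ 2 * D)%N by rewrite expnS expn1 -mulnA leq_pmulr // muln_gt0 L0.
  move=> LD; apply: leq_trans (leq_trans LD hL).
  by rewrite /L -{1}[mu]add0n ltn_add2r.
- by rewrite /m2 -map_mxM mxE l2.
- by rewrite /m3 -map_mxM mxE l3.
- exact: ltW.
- rewrite -/L -/C; set bt := _^-1.
  have b0 : 0 < bt by rewrite invr_gt0 exprn_gt0 // ltr0n.
  have h : p%:R * expR (- (bt * p%:R)) <= 4 / (bt ^+ 2 * p%:R).
    apply: le_trans (_ : p%:R * (4 / (bt * p%:R) ^+ 2) <= _).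
      by rewrite ler_pM2l // expRN_le_invsqr // mulr_gt0.
    by rewrite le_eqVlt; apply/orP; left; apply/eqP; field; rewrite !gt_eqF.
  have h2 : 4 / (bt ^+ 2 * p%:R) <= (2 * C%:R)^-1.
    rewrite ler_pdivrMr ?mulr_gt0 ?exprn_gt0 // ler_pdivlMl ?mulr_gt0 ?ltr0n //.
    rewrite /bt exprVn -exprM ler_pdivlMl ?exprn_gt0 ?ltr0n //.
    rewrite -natrX -!natrM ler_nat; apply: leq_trans hCp.
    by rewrite mulnC [(2 * C * 4)%N]mulnAC [(n * 2)%N]mulnC.
  have h3 : al <= (2 * C%:R)^-1.
    by rewrite -[leRHS]mul1r ler_pdivlMr ?mulr_gt0 ?ltr0n // mulrA.
  have -> : C%:R^-1 = (2 * C%:R)^-1 + (2 * C%:R)^-1 :> R.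
    by field; rewrite pnatr_eq0 -lt0n.
  by apply: lerD h3 (le_trans h h2).
move=> A' [A'card A'pat].
have [A [Abox Acard Apat]] := lift_Fp_set A' pp y1P y2P y3P y12.
exists A; split=> //; first by rewrite Acard.
move=> d d0; have [->|[e e0 le]] := Apat d d0.
  by rewrite mulr_ge0 ?divr_ge0 ?exprn_ge0.
rewrite -bD; apply: le_trans (A'pat e e0).
by rewrite ler_nat.
Qed.

(** * Choice of the dimension in terms of the density *)

Theorem theorem1p9 (R : realType) (r : nat) (P : {fset 'rV[int]_r}) (k : nat)
    (card_P : (3 <= #|` P|)%N)
    (dim_P : has_affine_dim R P k) (lt_dim : (k < r)%N) :
  exists c : R, 0 < c /\
    forall alpha : R, 0 < alpha < 1 / 2 ->
      pdd P alpha < alpha `^ (c * ln (1 / alpha)).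
Proof.
have [C C0 hC] := pdd_le_behrend card_P dim_P lt_dim.
have P0 : P != fset0 by rewrite -cardfs_gt0; apply: leq_trans card_P.
have r0 : (0 < r)%N by apply: leq_ltn_trans lt_dim.
pose l2 : R := ln 2; have l20 : 0 < l2 by rewrite ln_gt0 // ltr1n.
have eX n : (2 ^+ n)^-1 = expR (- (n%:R * l2)).
  by rewrite expRN expRM_natl lnK // posrE.
(* Chosen so that [1 + C * m.+1 <= K * m] for [m >= 1]; the value of [c] below then gives
   [c * (l2 * K * x) ^ 2 = l2 * x ^ 2 / 4]. *)
pose K : R := (1 + 2 * C)%:R.
have K0 : 0 < K by rewrite ltr0n.
exists (l2 * (2 * l2 * K) ^- 2); split.
  by rewrite divr_gt0 // exprn_gt0 // !mulr_gt0.
move=> al al01; have /andP[al0 al1] := al01.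
set c := l2 / _.
rewrite /powR gt_eqF // div1r lnV ?posrE //.
set t := - ln al.
have -> : c * t * ln al = - (c * t ^+ 2) by rewrite /t; ring.
have t0 : 0 < t by rewrite oppr_gt0 ln_lt0 // al0 /=; lra.
have small (x : R) : 0 < x -> t < l2 * K * x -> c * t ^+ 2 < l2 * x ^+ 2 / 4.
  move=> x0 tx; have tx2 : t ^+ 2 < (l2 * K * x) ^+ 2.
    by rewrite ltr_pXn2r // nnegrE ltW // !mulr_gt0.
  have -> : l2 * x ^+ 2 / 4 = c * (l2 * K * x) ^+ 2.
    by rewrite /c; field; rewrite !gt_eqF.
  by rewrite ltr_pM2l // divr_gt0 // exprn_gt0 // !mulr_gt0.
have ex_m : exists m, 1 < al * 2 * 2 ^+ (C * m.+1).
  exists (Num.bound al^-1); set N := Num.bound _.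
  have /archi_boundP hN : 0 <= al^-1 by rewrite invr_ge0 ltW.
  have : N%:R <= 2 ^+ (C * N.+1) :> R.
    rewrite -natrX ler_nat; apply: leq_trans (ltnW (ltn_expl N (ltnSn 1))) _.
    by rewrite leq_exp2l // (leq_trans (leqnSn N)) // leq_pmull.
  move/(lt_le_trans hN) => h.
  have : al * al^-1 < al * 2 ^+ (C * N.+1) by rewrite ltr_pM2l.
  by rewrite mulfV ?gt_eqF //; lra.
(* By minimality [m] is the last dimension satisfying the hypothesis of [hC], while the failure at
   [m.+1] bounds [t = ln (1 / al)] linearly in [m]. *)
pose m := ex_minn ex_m.
have [hm minm] : 1 < al * 2 * 2 ^+ (C * m.+1) /\
    forall n, 1 < al * 2 * 2 ^+ (C * n.+1) -> (m <= n)%N.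
  by rewrite /m; case: ex_minnP.
have tm : t < l2 * (1 + C * m.+1)%:R.
  have : 0 < ln (al * 2 * 2 ^+ (C * m.+1)) by rewrite ln_gt0.
  rewrite !lnM ?posrE ?mulr_gt0 ?exprn_gt0 // lnXn //.
  rewrite -/l2 /t -[l2 *+ _]mulr_natr natrD; lra.
(* For [m <= 1] the bound [4 / 2 ^+ (m ^ 2)] exceeds 1, so the bound [1 / 2] takes its place. *)
have [m1|m1] := leqP m 1.
  apply: le_lt_trans (pdd_le_half P0 r0 al01) _.
  have -> : 1 / 2 = expR (- l2) by rewrite div1r expRN lnK // posrE.
  rewrite ltr_expR ltrN2; apply: lt_trans (small 1 ltr01 _) _; last by lra.
  apply: lt_le_trans tm _; rewrite mulr1 ler_pM2l // ler_nat; nia.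
apply: le_lt_trans (hC m al (ltnW m1) al0 _) _.
  rewrite leNgt; apply/negP; case: (m) m1 minm => // m' _ minm /minm.
  by rewrite ltnn.
have m0 : 0 < m%:R :> R by rewrite ltr0n ltnW.
have -> : 4 / 2 ^+ (m ^ 2) = expR (2%:R * l2 - (m ^ 2)%:R * l2).
  by rewrite eX expRD expRM_natl lnK ?posrE // -natrX.
rewrite ltr_expR ltrNr opprB.
apply: lt_le_trans (small m%:R m0 _) _.
  apply: lt_le_trans tm _; rewrite -mulrA ler_pM2l // -natrM ler_nat; nia.
(* As [m >= 2], the prefactor 4 costs at most half of the exponent [m ^ 2], and a quarter is all
   that is needed. *)
have : 4 <= (m ^ 2)%:R :> R by rewrite ler_nat -[4%N]/(2 ^ 2)%N leq_exp2r.
by rewrite natrX; nra.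
Qed.
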